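(* Let $m\in\mathbb{N}$ and $n_1,\dots,n_m\in\mathbb{N}$ be known. Let $X_{i,j}\sim\mathrm{Po}(\lambda_{i,j})$, $j=1,\dots,n_i$, $i=1,\dots,m$, and $Y_i\sim\mathrm{Po}(\lambda_{i,\cdot})$, $i=1,\dots,m$, be mutually independent, where $\lambda_{i,j}\in(0,\infty)$ are unknown and $\lambda_{i,\cdot}=\sum_{j=1}^{n_i}\lambda_{i,j}$. Consider estimation of $\lambda=((\lambda_{i,j})_{j=1,\dots,n_i})_{i=1,\dots,m}$ on the basis of $X=((X_{i,j})_j)_i$ and $Y=(Y_i)_i$ under the loss $$L(d,\lambda)=\sum_{i=1}^m\sum_{j=1}^{n_i}\frac{(d_{i,j}-\lambda_{i,j})^2}{\lambda_{i,j}}.$$ Put $X_{i,\cdot}=\sum_{j=1}^{n_i}X_{i,j}$, $X_{\cdot,\cdot}=\sum_{i=1}^m X_{i,\cdot}$, $Y_\cdot=\sum_{i=1}^mY_i$, and define estimators $\hat\lambda^{\mathrm{ML}}(X,Y)$, $\hat\lambda^{\mathrm{O}}(X,Y)$, $\hat\lambda(X,Y)$ with $(i,j)$ components $$\hat\lambda^{\mathrm{ML}}_{i,j}=\frac{X_{i,\cdot}+Y_i}{2}\frac{X_{i,j}}{X_{i,\cdot}},\qquad \hat\lambda^{\mathrm{O}}_{i,j}=\frac{X_{i,\cdot}+Y_i+n_i-1}{2}\frac{X_{i,j}}{X_{i,\cdot}+n_i-1},$$ $$\hat\lambda_{i,j}=\frac{X_{\cdot,\cdot}+Y_\cdot}{2}\,\frac{X_{i,\cdot}+Y_i}{X_{\cdot,\cdot}+Y_\cdot+m-1}\,\frac{X_{i,j}}{X_{i,\cdot}+n_i-1}.$$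 Then: (i) If $\max_{1\le i\le m}n_i\ge2$, then $\hat\lambda^{\mathrm{ML}}(X,Y)$ is dominated by $\hat\lambda^{\mathrm{O}}(X,Y)$. (ii) If $m\ge2$, $\min_{1\le i\le m}n_i\ge4$, and $$\frac{(m-1)^2}{2m}+\frac{m-1}{m^2}+\frac{2n_i-3}{m}\le\frac{(n_i-1)(n_i-3)}{2}\quad\text{for all } i=1,\dots,m,$$ then $\hat\lambda^{\mathrm{O}}(X,Y)$ is dominated by $\hat\lambda(X,Y)$.
   Context: $\mathrm{Po}(\mu)$ is the Poisson distribution with mean $\mu$. The risk of an estimator $\delta$ at $\lambda$ is $E_\lambda[L(\delta(X,Y),\lambda)]$. An estimator $\delta$ is dominated by $\delta'$ if the risk of $\delta'$ is at most the risk of $\delta$ for every $\lambda$ in the parameter space $(0,\infty)^{n_1}\times\cdots\times(0,\infty)^{n_m}$, with strict inequality for at least one $\lambda$. Convention: $0/0$ is read as $0$, so that $\hat\lambda^{\mathrm{ML}}_{i,j}=0$ when $X_{i,\cdot}=0$, and likewise $\hat\lambda^{\mathrm{O}}_{i,j}=0$ when $X_{i,\cdot}=0$ (relevant only if $n_i=1$). *)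

(* Defs.v *)
From HB Require Import structures.
From mathcomp Require Export all_boot all_order all_algebra.
From mathcomp Require Export all_classical all_reals all_analysis.

Set Implicit Arguments.
Unset Strict Implicit.
Unset Printing Implicit Defensive.

Import Order.TTheory GRing.Theory Num.Theory.

Local Open Scope classical_set_scope.
Local Open Scope ring_scope.

Section Independence.
Context {d d' : measure_display} {T : measurableType d}
  {T' : measurableType d'} {R : realType}.

Definition mutually_independent (P : probability T R) (I : finType)
    (Z : I -> {mfun T >-> T'}) : Prop :=
  forall (J : {set I}) (A : I -> set T'),
    (forall k, measurable (A k)) ->
    P (\bigcap_(k in [set` J]) (Z k @^-1` A k)) =
    (\prod_(k in J) P (Z k @^-1` A k))%E.

End Independence.

(* The library's [poisson_prob mu k] does not depend on its argument [k]. *)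
Definition poisson_distributed {d : measure_display} {T : measurableType d}
    {R : realType} (P : probability T R) (Z : {mfun T >-> nat}) (mu : R) :
    Prop :=
  forall A : set nat, distribution P Z A = poisson_prob mu 0%N A.

Section Model.
Context {R : realType} {m : nat}.
Variable n : 'I_m -> nat.

(* Ragged arrays: the entry (i, j) exists for j < n i. *)
Definition array (E : Type) : Type := forall i : 'I_m, 'I_(n i) -> E.

Definition row_sum (a : array R) (i : 'I_m) : R := \sum_(j < n i) a i j.

Definition param_space : set (array R) :=
  [set lam | forall i (j : 'I_(n i)), 0 < lam i j].

Definition estimator : Type := array nat -> ('I_m -> nat) -> array R.

Definition loss (e lam : array R) : R :=
  \sum_(i < m) \sum_(j < n i) (e i j - lam i j) ^+ 2 / lam i j.

(* All the observations, as one family: [inl] for the X_{i,j}, [inr] for the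
   Y_i. *)
Definition observations (V : Type) (X : array V) (Y : 'I_m -> V)
    (k : {i : 'I_m & 'I_(n i)} + 'I_m) : V :=
  match k with
  | inl p => X (tag p) (tagged p)
  | inr i => Y i
  end.

Section Risk.
Context {d : measure_display} {T : measurableType d}.
Variables (P : array R -> probability T R).
Variables (X : array {mfun T >-> nat}) (Y : 'I_m -> {mfun T >-> nat}).
Arguments X : clear implicits.

Definition risk (delta : estimator) (lam : array R) : \bar R :=
  ('E_(P lam) [fun t : T =>
     loss (delta (fun i j => X i j t) (fun i => Y i t)) lam])%E.

Definition dominated_by (delta delta' : estimator) : Prop :=
  (forall lam, param_space lam -> (risk delta' lam <= risk delta lam)%E) /\
  (exists2 lam, param_space lam & (risk delta' lam < risk delta lam)%E).

End Risk.

Section Estimators.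
Variables (x : array nat) (y : 'I_m -> nat).
Arguments x : clear implicits.

Definition row_count (i : 'I_m) : nat := (\sum_(j < n i) x i j)%N.
Definition x_total : nat := (\sum_(i < m) row_count i)%N.
Definition y_total : nat := (\sum_(i < m) y i)%N.

(* Division by zero yields zero in MathComp, which is the convention 0/0 = 0;
   [n i - 1] and [m - 1] are subtractions in [R], not truncated ones. *)
Definition lambda_ML : array R := fun i j =>
  ((row_count i)%:R + (y i)%:R) / 2 * ((x i j)%:R / (row_count i)%:R).

Definition lambda_O : array R := fun i j =>
  ((row_count i)%:R + (y i)%:R + (n i)%:R - 1) / 2 *
  ((x i j)%:R / ((row_count i)%:R + (n i)%:R - 1)).

Definition lambda_hat : array R := fun i j =>
  (x_total%:R + y_total%:R) / 2 *
  (((row_count i)%:R + (y i)%:R) / (x_total%:R + y_total%:R + m%:R - 1)) *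
  ((x i j)%:R / ((row_count i)%:R + (n i)%:R - 1)).

End Estimators.
End Model.

Arguments estimator R {m} n.
Arguments lambda_ML R {m n}.
Arguments lambda_O R {m n}.
Arguments lambda_hat R {m n}.

(* Main.v *)
Require Import Defs.
From mathcomp Require Import ring lra zify measurable_realfun.
Set Implicit Arguments.
Unset Strict Implicit.
Unset Printing Implicit Defensive.
Import Order.TTheory GRing.Theory Num.Theory.
Local Open Scope classical_set_scope.
Local Open Scope ring_scope.

(** Everything rests on the Stein-type identity [E (Z F Z) = mu E (F (Z + 1))]
for a Poisson variable [Z] of mean [mu], applied to one coordinate of the
observation vector. All three estimators have the form [c_i X_ij] with [c_i] a
function of the row counts [N_i] and of [Y]; summing the identity over a row
turns the risk into
[sum_i (E (N_i c_i^2 (N_i + a_i)) / L_i - 2 E (N_i c_i) + L_i)], where [a_i = n_i - 1] and [L_i] is the row mean.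

(i) Integrating out [Y_i], the risk difference in row [i] is
[a (E u / 2 + (L + 1) / 4 (A + B) - L B)] with [u = 1_(N > 0)], [A = E (u / N)],
[B = E (u / (N + a))]. If [C = E (u / (N + 1))] then [A >= C >= B > 0], and
[L C = P (N >= 2) <= E u], so the bracket is at least [B / 2].

(ii) Let [Z_i = N_i + Y_i], [b = m - 1], [w_i = Z_i + 1] and [W = sum_i w_i].
Applying the identity to [Z_i], of mean [2 L_i], makes the risk difference the
expectation of a sum over [i] of terms at least
[(H_i a_i^2 / w_i - H_i b^2 w_i / W^2) / 2], where [H_i] is the average of
[N / (N + a)] over [N = N_i, N_i + 1]. For [a_i >= 3] one has [H_i a_i^2 >= 1]
and [H_i <= 1], so the sum is at least [(m^2 - b^2) / (2 W) > 0] by convexity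
of [1 / w]. *)

(** * Integrals of functions of a countably valued map *)

Section CountableValues.
Context {d : measure_display} {T : measurableType d} {R : realType}.
Context {K : countType} (Z : T -> K).
Hypothesis mZ : forall z, measurable (Z @^-1` [set z]).

(** The preimage is a union of measurable fibres indexed by codes in [nat]; codes that decode to
    nothing contribute [set0]. *)
Lemma measurable_preimage_countable (A : set K) : measurable (Z @^-1` A).
Proof.
rewrite (_ : _ @^-1` _ = \bigcup_n (if @unpickle K n is Some z then
  (if `[< A z >] then Z @^-1` [set z] else set0) else set0)); last first.
  apply/seteqP; split=> t /=.
    by move=> At; exists (pickle (Z t)) => //=; rewrite pickleK; case: asboolP.
  by case=> k _; case: unpickle => // z; case: asboolP => //= Az ->.
apply: bigcup_measurable => k _; case: unpickle => // z.
by case: ifP.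
Qed.

Lemma measurable_fun_countable d' (U : sigmaRingType d') (f : K -> U) :
  measurable_fun setT (f \o Z).
Proof.
by move=> _ B mB; rewrite setTI comp_preimage; exact: measurable_preimage_countable.
Qed.

Lemma emeasurable_fun_countable (f : K -> \bar R) :
  measurable_fun setT (fun t => f (Z t)).
Proof. exact: measurable_fun_countable. Qed.

(** The fibres of [Z] partition [T] and [f \o Z] is constant on each of them. *)
Lemma ge0_integral_countable (mu : measure T R) (f : K -> \bar R) :
  (forall z, 0 <= f z)%E ->
  (\int[mu]_t f (Z t) = \esum_(z in [set: K]) (f z * mu (Z @^-1` [set z])))%E.
Proof.
move=> f0.
pose F k := Z @^-1` (pickle @^-1` [set k]).
have FT : \bigcup_k F k = setT.
  by apply/seteqP; split=> t // _; exists (pickle (Z t)).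
rewrite -{1}FT ge0_integral_bigcup; first last.
- by move=> i j _ _ [t []]; rewrite /F /= => -> ->.
- by move=> t _; exact: f0.
- by rewrite FT; exact: measurable_fun_countable.
- by move=> k; exact: measurable_preimage_countable.
rewrite nneseries_esumT; last by move=> k; apply: integral_ge0 => t _; exact: f0.
(* The series runs over all codes; those outside the range of [pickle] have an empty fibre, which
   leaves a sum over [K]. *)
rewrite (_ : [set: nat] = range (@pickle K) `|` ~` range (@pickle K)); last first.
  by rewrite setUCr.
rewrite (esumID (range (@pickle K))); last first.
  by move=> k _; apply: integral_ge0 => t _; exact: f0.
rewrite setUCr !setTI [X in (_ + X)%E]esum1 ?adde0; last first.
  move=> k nk; rewrite (_ : F k = set0) ?integral_set0//.
  by apply/seteqP; split=> // t /= kE; apply: nk; exists (Z t).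
have bij_pickle : set_bij [set: K] (range (@pickle K)) pickle.
  split; [by move=> z _; exists z| |by move=> k].
  by move=> z w _ _; exact: (pcan_inj pickleK).
rewrite (reindex_esum _ _ _ _ bij_pickle); apply: eq_esum => z _.
have -> : F (pickle z) = Z @^-1` [set z].
  by apply/seteqP; split=> t; rewrite /F /=; [move/(pcan_inj pickleK)|move->].
under eq_integral => t /set_mem /= -> do over.
by rewrite integral_cst.
Qed.

End CountableValues.

(** * Functions of polynomial growth on count vectors *)

Section PolynomialGrowth.
Context {R : realType} {K : finType}.
Implicit Types (f g : {ffun K -> nat} -> R) (z : {ffun K -> nat}).

Definition incr (k : K) z : {ffun K -> nat} := [ffun l => (z l + (l == k))%N].

(** The successor keeps the weight at least 1, so its powers increase with the exponent and bounds
    of different degrees can be added. *)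
Definition weight z : nat := (\sum_k z k).+1.

Lemma weight_incr k z : weight (incr k z) = (weight z).+1.
Proof.
rewrite /weight; under eq_bigr do rewrite ffunE.
rewrite big_split /= [X in (_ + X)%N](bigD1 k)//= eqxx.
rewrite [X in (_ + (_ + X))%N]big1 ?addn0 ?addn1//.
by move=> l /negbTE ->.
Qed.

Lemma weight_ge1 z : 1 <= (weight z)%:R :> R.
Proof. by rewrite ler1n. Qed.

(** A class stable under ring operations and unit shifts whose members are integrable under every
    product of Poisson laws; integrability thus reduces to closure rules. *)
Definition poly_growth f : Prop :=
  exists C p, forall z, `|f z| <= C * (weight z)%:R ^+ p.

Lemma poly_growth_le f g : (forall z, `|f z| <= `|g z|) ->
  poly_growth g -> poly_growth f.
Proof.
by move=> fg [C [p Cp]]; exists C, p => z; exact: le_trans (Cp z).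
Qed.

Lemma poly_growthP f : poly_growth f ->
  exists C p, [/\ 0 <= C & forall z, `|f z| <= C * (weight z)%:R ^+ p].
Proof.
move=> [C [p Cp]]; exists `|C|, p; split=> // z; apply: le_trans (Cp z) _.
by rewrite ler_wpM2r ?exprn_ge0// ler_norm.
Qed.

Lemma poly_growth_cst c : poly_growth (fun=> c).
Proof. by exists `|c|, 0%N => z; rewrite expr0 mulr1. Qed.

Lemma poly_growthM f g : poly_growth f -> poly_growth g ->
  poly_growth (fun z => f z * g z).
Proof.
move=> /poly_growthP[C [p [C0 Cp]]] /poly_growthP[D [q [D0 Dq]]].
exists (C * D), (p + q)%N => z.
by rewrite normrM exprD mulrACA ler_pM.
Qed.

Lemma poly_growthD f g : poly_growth f -> poly_growth g ->
  poly_growth (fun z => f z + g z).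
Proof.
move=> /poly_growthP[C [p [C0 Cp]]] /poly_growthP[D [q [D0 Dq]]].
exists (C + D), (p + q)%N => z.
rewrite (le_trans (ler_normD _ _))// mulrDl lerD//.
  rewrite (le_trans (Cp z))// ler_wpM2l// ler_weXn2l ?leq_addr//.
  exact: weight_ge1.
rewrite (le_trans (Dq z))// ler_wpM2l// ler_weXn2l ?leq_addl//.
exact: weight_ge1.
Qed.

Lemma poly_growthN f : poly_growth f -> poly_growth (fun z => - f z).
Proof. by apply: poly_growth_le => z; rewrite normrN. Qed.

Lemma poly_growthB f g : poly_growth f -> poly_growth g ->
  poly_growth (fun z => f z - g z).
Proof. by move=> pf pg; apply/poly_growthD/poly_growthN. Qed.

Lemma poly_growthX f p : poly_growth f -> poly_growth (fun z => f z ^+ p).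
Proof.
move=> pf; elim: p => [|p IH]; first exact: poly_growth_cst.
by under eq_fun do rewrite exprS; exact: poly_growthM.
Qed.

Lemma poly_growth_sum I (r : seq I) (f : I -> {ffun K -> nat} -> R) :
  (forall i, poly_growth (f i)) -> poly_growth (fun z => \sum_(i <- r) f i z).
Proof.
move=> pf; elim: r => [|i r IH].
  by under eq_fun do rewrite big_nil; exact: poly_growth_cst.
by under eq_fun do rewrite big_cons; exact: poly_growthD.
Qed.

Lemma poly_growth_weight : poly_growth (fun z => (weight z)%:R).
Proof. by exists 1, 1%N => z; rewrite mul1r expr1 ger0_norm. Qed.

Lemma poly_growth_coord k : poly_growth (fun z => (z k)%:R).
Proof.
apply: poly_growth_le poly_growth_weight => z; rewrite !normr_nat ler_nat.
by rewrite /weight (bigD1 k)//= -addnS leq_addr.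
Qed.

Lemma poly_growth_invn (u : {ffun K -> nat} -> nat) :
  poly_growth (fun z => (u z)%:R^-1).
Proof.
apply: poly_growth_le (poly_growth_cst 1) => z.
rewrite normr1 ger0_norm ?invr_ge0//.
by case: (u z) => [|k]; rewrite ?invr0// invf_le1 ?ltr0n ?ler1n.
Qed.

Lemma poly_growth_bool (b : {ffun K -> nat} -> bool) :
  poly_growth (fun z => (b z)%:R).
Proof.
by apply: poly_growth_le (poly_growth_cst 1) => z; case: (b z); rewrite ?normr0 normr1.
Qed.

(** A weight [w >= 1] satisfies [w + 1 <= 2 * w], so a shift costs only the factor [2 ^+ p]. *)
Lemma poly_growth_incr k f : poly_growth f -> poly_growth (f \o incr k).
Proof.
move=> /poly_growthP[C [p [C0 Cp]]]; exists (C * 2 ^+ p), p => z /=.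
rewrite (le_trans (Cp _))// -mulrA -exprMn ler_wpM2l// lerXn2r ?nnegrE ?mulr_ge0//.
by rewrite weight_incr -natrM ler_nat mul2n -addnn -addn1 leq_add2l.
Qed.

End PolynomialGrowth.

(** * Stein's identity and expectations for independent Poisson variables *)

Section PoissonVector.
Context {d : measure_display} {T : measurableType d} {R : realType}.
Context {K : finType} (P : probability T R) (V : K -> {mfun T >-> nat}).
Variable mu : K -> R.
Hypothesis mu_gt0 : forall k, 0 < mu k.
Hypothesis V_poisson : forall k, poisson_distributed P (V k) (mu k).
Hypothesis V_indep : mutually_independent P V.
Implicit Types (f g : {ffun K -> nat} -> R) (z : {ffun K -> nat}).

(** Packed into one finite function, the family takes countably many values, so integrals become
    sums over [{ffun K -> nat}]. *)
Let W (t : T) : {ffun K -> nat} := [ffun k => V k t].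

Let preimage_W z : W @^-1` [set z] =
  \bigcap_(k in [set` [set: K]%SET]) (V k @^-1` [set z k]).
Proof.
apply/seteqP; split=> t /=.
  by move=> <- k _ /=; rewrite ffunE.
by move=> Vz; apply/ffunP => k; rewrite ffunE; apply: Vz => /=; rewrite inE.
Qed.

Lemma measurable_joint z : measurable (W @^-1` [set z]).
Proof.
rewrite preimage_W; apply: fin_bigcap_measurable => [|k _].
  exact: finite_finset.
by rewrite -[_ @^-1` _]setTI; exact: measurable_funPT.
Qed.

Lemma joint_pmf z :
  P (W @^-1` [set z]) = (\prod_k poisson_pmf (mu k) (z k))%:E.
Proof.
rewrite preimage_W V_indep//.
transitivity (\prod_(k in [set: K]%SET) (poisson_pmf (mu k) (z k))%:E)%E.
  apply: eq_bigr => k _; have := V_poisson k [set z k].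
  rewrite /distribution /pushforward => ->.
  rewrite /poisson_prob mu_gt0 esum_set1// lee_fin.
  exact: poisson_pmf_ge0.
rewrite -prodEFin; apply: eq_bigl => k; exact: finset.in_setT.
Qed.

(** In coordinate [k] the factor [z k + 1] cancels against the factorial and leaves one [mu k]; the
    other factors do not change. *)
Lemma pmf_incr k z : (incr k z k)%:R * (\prod_l poisson_pmf (mu l) (incr k z l))
  = mu k * \prod_l poisson_pmf (mu l) (z l).
Proof.
rewrite (bigD1 k)//= [in RHS](bigD1 k)//= !mulrA; congr (_ * _).
  rewrite ffunE eqxx addn1 /poisson_pmf mu_gt0 exprS factS natrM invfM.
  rewrite !mulrA; congr (_ * _); congr (_ / _).
  by rewrite mulrC !mulrA mulVf ?pnatr_eq0// mul1r.
by apply: eq_bigr => l /negbTE lk; rewrite ffunE lk addn0.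
Qed.

Lemma ge0_poisson_stein k f : (forall z, 0 <= f z) ->
  (\int[P]_t ((W t k)%:R * f (W t))%:E =
   (mu k)%:E * \int[P]_t (f (incr k (W t)))%:E)%E.
Proof.
move=> f0; pose W0 := measurable_joint.
rewrite -ge0_integralZl//; last 3 first.
- exact: (emeasurable_fun_countable W0 (fun z => (f (incr k z))%:E)).
- by move=> t _; rewrite lee_fin.
- by rewrite lee_fin ltW.
rewrite (ge0_integral_countable W0 P
  (f := fun z => ((z k)%:R * f z)%:E)); last first.
  by move=> z; rewrite lee_fin mulr_ge0.
rewrite (ge0_integral_countable W0 P
  (f := fun z => ((mu k)%:E * (f (incr k z))%:E)%E)); last first.
  by move=> z; rewrite -EFinM lee_fin mulr_ge0// ltW.
rewrite (esumID (range (incr k))); last first.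
  by move=> z _; rewrite mule_ge0// lee_fin mulr_ge0.
(* A vector outside the range of [incr k] has [z k = 0], so its term vanishes; the others are
   reindexed by [incr k]. *)
rewrite !setTI [X in (_ + X)%E]esum1 ?adde0; last first.
  move=> z nz; suff -> : z k = 0%N by rewrite mul0r mul0e.
  apply/eqP; rewrite -leqn0 leqNgt; apply/negP => z0; apply: nz.
  exists [ffun l => (z l - (l == k))%N] => //; apply/ffunP => l; rewrite !ffunE.
  by have [->|] := eqVneq l k; [rewrite subnK|rewrite subn0 addn0].
have bij_incr : set_bij [set: {ffun K -> nat}] (range (incr k)) (incr k).
  split; [by move=> z _; exists z| |by move=> z].
  move=> z w _ _ /ffunP zw; apply/ffunP => l.
  by have := zw l; rewrite !ffunE => /addIn.
rewrite (reindex_esum _ _ _ _ bij_incr); apply: eq_esum => z _.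
rewrite /= !joint_pmf -!EFinM; congr EFin.
by rewrite mulrAC pmf_incr; ring.
Qed.

(** By induction on [p]: one factor of the weight [w] is split as [1 + \sum_k z k], and Stein's
    identity trades [z k * w ^+ p] for [mu k * (w + 1) ^+ p], which is at most
    [mu k * 2 ^+ p * w ^+ p]. *)
Lemma weight_moment_lty p :
  (\int[P]_t ((weight (W t))%:R ^+ p)%:E < +oo)%E.
Proof.
have mE f : measurable_fun [set: T] (fun t => (f (W t))%:E).
  exact: (emeasurable_fun_countable measurable_joint (EFin \o f)).
elim: p => [|p IH].
  under eq_integral do rewrite expr0.
  by rewrite integral_cst//= mul1e probability_setT ltry.
have w0 z q : 0 <= (weight z)%:R ^+ q :> R by rewrite exprn_ge0.
have -> : (\int[P]_t ((weight (W t))%:R ^+ p.+1)%:E =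
    \int[P]_t (((weight (W t))%:R ^+ p)%:E +
      \sum_(k <- index_enum K) ((W t k)%:R * (weight (W t))%:R ^+ p)%:E))%E.
  apply: eq_integral => t _; rewrite sumEFin -EFinD -mulr_suml exprS.
  by rewrite -[X in X + _]mul1r -mulrDl -natr_sum nat1r.
rewrite (ge0_integralD P measurableT); last 4 first.
- by move=> t _; rewrite lee_fin.
- exact: (mE (fun z => (weight z)%:R ^+ p)).
- by move=> t _; apply: sume_ge0 => k _; rewrite lee_fin mulr_ge0.
- apply: emeasurable_sum => k.
  exact: (mE (fun z => (z k)%:R * (weight z)%:R ^+ p)).
rewrite lte_add_pinfty// (ge0_integral_sum P measurableT); last 2 first.
- by move=> k; exact: (mE (fun z => (z k)%:R * (weight z)%:R ^+ p)).
- by move=> k t _; rewrite lee_fin mulr_ge0.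
apply: lte_sum_pinfty => k _.
rewrite (@ge0_poisson_stein k (fun z => (weight z)%:R ^+ p))// lte_mul_pinfty//.
  by rewrite lee_fin ltW.
apply: (@le_lt_trans _ _ (\int[P]_t ((2 ^+ p)%:E * ((weight (W t))%:R ^+ p)%:E))%E).
  apply: ge0_le_integral => //.
  - exact: (mE (fun z => (weight (incr k z))%:R ^+ p)).
  - exact: (mE (fun z => 2 ^+ p * (weight z)%:R ^+ p)).
  move=> t _; rewrite -EFinM lee_fin -exprMn lerXn2r ?nnegrE ?mulr_ge0//.
  by rewrite weight_incr -natrM ler_nat mul2n -addnn -addn1 leq_add2l.
rewrite (ge0_integralZl P measurableT); last 3 first.
- exact: (mE (fun z => (weight z)%:R ^+ p)).
- by move=> t _; rewrite lee_fin.
- by rewrite lee_fin exprn_ge0.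
by rewrite lte_mul_pinfty// lee_fin exprn_ge0.
Qed.

Lemma poly_growth_integrable f : poly_growth f ->
  P.-integrable setT (fun t => (f (W t))%:E).
Proof.
move=> /poly_growthP[C [p [C0 Cp]]].
have mE g : measurable_fun [set: T] (fun t => (g (W t))%:E).
  exact: (emeasurable_fun_countable measurable_joint (EFin \o g)).
apply: (@le_integrable _ _ _ P _ measurableT _
    (fun t => C%:E * ((weight (W t))%:R ^+ p)%:E)%E).
- exact: mE.
- by move=> t _; rewrite /= lee_fin [leRHS]ger0_norm ?mulr_ge0 ?exprn_ge0//.

apply: integrableZl => //; apply/integrableP; split.
  exact: (mE (fun z => (weight z)%:R ^+ p)).
under eq_integral do rewrite gee0_abs ?lee_fin ?exprn_ge0//.
exact: weight_moment_lty.
Qed.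

Definition expect f : R := (\int[P]_t f (W t))%R.

Lemma eq_expect f g : (forall z, f z = g z) -> expect f = expect g.
Proof. by move=> fg; congr expect; exact/funext. Qed.

Lemma expectD f g : poly_growth f -> poly_growth g ->
  expect (fun z => f z + g z) = expect f + expect g.
Proof. by move=> pf pg; apply: RintegralD => //; exact: poly_growth_integrable. Qed.

Lemma expectB f g : poly_growth f -> poly_growth g ->
  expect (fun z => f z - g z) = expect f - expect g.
Proof. by move=> pf pg; apply: RintegralB => //; exact: poly_growth_integrable. Qed.

Lemma expectZ c f : poly_growth f ->
  expect (fun z => c * f z) = c * expect f.
Proof. by move=> pf; apply: RintegralZl => //; exact: poly_growth_integrable. Qed.

Lemma expect_cst c : expect (fun=> c) = c.
Proof. by rewrite /expect Rintegral_cst//= probability_setT mulr1. Qed.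

Lemma expect_sum I (r : seq I) (f : I -> {ffun K -> nat} -> R) :
  (forall i, poly_growth (f i)) ->
  expect (fun z => \sum_(i <- r) f i z) = \sum_(i <- r) expect (f i).
Proof.
move=> pf; elim: r => [|i r IH].
  by rewrite big_nil; under eq_expect do rewrite big_nil; rewrite expect_cst.
rewrite big_cons; under eq_expect do rewrite big_cons.
by rewrite expectD ?IH//; exact: poly_growth_sum.
Qed.

Lemma le_expect f g : poly_growth f -> poly_growth g ->
  (forall z, f z <= g z) -> expect f <= expect g.
Proof.
by move=> pf pg fg; apply: le_Rintegral => //; exact: poly_growth_integrable.
Qed.

Lemma expect_gt0 f : poly_growth f -> (forall z, 0 < f z) -> 0 < expect f.
Proof.
move=> pf f0; have f0' z : 0 <= f z by exact: ltW.
have If := poly_growth_integrable pf.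
rewrite lt_neqAle Rintegral_ge0 ?andbT; last by move=> t _; exact: f0'.
apply/negP => /eqP E0.
have I0 : (\int[P]_t `|(f (W t))%:E| = 0)%E.
  under eq_integral do rewrite gee0_abs ?lee_fin//.
  rewrite -[LHS]fineK; last exact: integrable_fin_num.
  by congr EFin; rewrite [RHS]E0.
have mf : measurable_fun [set: T] (fun t => (f (W t))%:E).
  by case/integrableP: If.
have [/(_ I0)[A [mA A0 sA]] _] := ae_eq_integral_abs P measurableT mf.
(* [f] vanishes off the null set [A] but is positive everywhere, so [A] is the whole space, of
   probability 1. *)
have : (P setT <= P A)%E.
  apply: le_measure; rewrite ?inE// => t _; apply: sA => /(_ I) /= [] ft.
  by move: (f0 (W t)); rewrite ft ltxx.
by rewrite probability_setT [X in (_ <= X)%E]A0 lee_fin ler10.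
Qed.

Lemma expectationE f : poly_growth f ->
  ('E_P[fun t => f (W t)] = (expect f)%:E)%E.
Proof.
move=> pf; rewrite unlock /expect /Rintegral fineK//.
exact/integrable_fin_num/poly_growth_integrable.
Qed.

(* The polynomial bound [B] reduces the signed identity to the nonnegative one
   applied to [f + B] and to [B]. *)
Lemma poisson_stein k f : poly_growth f ->
  expect (fun z => (z k)%:R * f z) = mu k * expect (f \o incr k).
Proof.
move=> pf; have pk := @poly_growth_coord R K k.
have ge0 g : poly_growth g -> (forall z, 0 <= g z) ->
    expect (fun z => (z k)%:R * g z) = mu k * expect (g \o incr k).
  move=> pg g0; rewrite /expect /Rintegral ge0_poisson_stein// fineM//.
  apply: integrable_fin_num => //; apply: (poly_growth_integrable (f := g \o _)).
  exact: poly_growth_incr.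
have [C [p [C0 Cp]]] := poly_growthP pf.
pose B z : R := C * (weight z)%:R ^+ p.
have pB : poly_growth B.
  exact: poly_growthM (poly_growth_cst C) (poly_growthX _ (poly_growth_weight)).
have B0 z : 0 <= B z by rewrite mulr_ge0// exprn_ge0.
have fB0 z : 0 <= f z + B z.
  by have := Cp z; rewrite ler_norml -subr_ge0 opprK => /andP[].
have pfB := poly_growthD pf pB.
have -> : expect (fun z => (z k)%:R * f z) =
    expect (fun z => (z k)%:R * (f z + B z)) - expect (fun z => (z k)%:R * B z).
  rewrite -expectB; try exact: poly_growthM.
  by apply: eq_expect => z; ring.
rewrite !ge0// -mulrBr -expectB; try exact: poly_growth_incr.
by congr (_ * _); apply: eq_expect => z /=; rewrite addrK.
Qed.

End PoissonVector.

(** * Pointwise identities and inequalities between the multipliers *)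

Section Algebra.
Context {R : realType}.

(** The right-hand side exhibits a factor [y], ready for Stein's identity in [Y_i]. The indicator of
    [0 < k] covers the convention at an empty row, where both sides vanish. *)
Lemma quad_ML_O (k y a : nat) :
  k%:R * (((k%:R + y%:R) / 2 / k%:R) ^+ 2 * (k%:R + a%:R)) -
  k%:R * (((k%:R + y%:R + a%:R) / 2 / (k + a)%:R) ^+ 2 * (k%:R + a%:R)) =
  y%:R * (a%:R / 4 * (2 * (0 < k)%:R +
    y%:R * (k%:R^-1 + (0 < k)%:R * (k + a)%:R^-1))) :> R.
Proof.
case: k => [|k]; first by rewrite ltnn !mulr0n invr0 !(mul0r, mulr0, addr0) subrr.
rewrite ltn0Sn mulr1n !natrD; have k0 : 0 < k.+1%:R :> R by [].
move: k.+1%:R k0 => x x0.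
have xa0 : 0 < x + a%:R by rewrite ltr_wpDr.
by field; rewrite !lt0r_neq0.
Qed.

Lemma lin_ML_O (k y a : nat) :
  k%:R * ((k%:R + y%:R) / 2 / k%:R) -
  k%:R * ((k%:R + y%:R + a%:R) / 2 / (k + a)%:R) =
  a%:R / 2 * (y%:R * ((0 < k)%:R * (k + a)%:R^-1)) :> R.
Proof.
case: k => [|k]; first by rewrite ltnn !mulr0n !(mul0r, mulr0) subrr.
rewrite ltn0Sn mulr1n !natrD; have k0 : 0 < k.+1%:R :> R by [].
move: k.+1%:R k0 => x x0.
have xa0 : 0 < x + a%:R by rewrite ltr_wpDr.
by field; rewrite !lt0r_neq0.
Qed.

(* [b / (s + b)] is the fraction by which [lambda_hat] shrinks; multiplied by
   [k + y], this is the difference of the quadratic parts of the two row risks,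
   so that Stein's identity applies to both counts. *)
Definition shrink_gain (k y a b s : nat) : R :=
  k%:R / (k + a)%:R / 4 * (2 * a%:R + a%:R ^+ 2 / (k + y)%:R
    + 2 * (b%:R / (s + b)%:R) * (k + y)%:R
    - (b%:R / (s + b)%:R) ^+ 2 * (k + y)%:R).

Lemma quad_O_hat (k y a b s : nat) : (0 < b)%N -> (0 < a)%N ->
  k%:R * (((k%:R + y%:R + a%:R) / 2 / (k + a)%:R) ^+ 2 * (k%:R + a%:R)) -
  k%:R * ((s%:R / 2 * ((k%:R + y%:R) / (s + b)%:R) / (k + a)%:R) ^+ 2
    * (k%:R + a%:R)) =
  k%:R * shrink_gain k y a b s + y%:R * shrink_gain k y a b s.
Proof.
move=> b0 a0; rewrite /shrink_gain.
case: k => [|k]; first by rewrite !mulr0n !(mul0r, mulr0) subrr addr0.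
have sb0 : 0 < s%:R + b%:R :> R by rewrite -natrD ltr0n addn_gt0 b0 orbT.
rewrite !natrD; have k0 : 0 < k.+1%:R :> R by [].
move: k.+1%:R k0 => x x0.
have xa0 : 0 < x + a%:R by rewrite ltr_wpDr.
have xy0 : 0 < x + y%:R by rewrite ltr_wpDr.
by field; rewrite !lt0r_neq0.
Qed.

Lemma lin_O_hat (k y a b s : nat) : (0 < b)%N -> (0 < a)%N ->
  k%:R * ((k%:R + y%:R + a%:R) / 2 / (k + a)%:R) -
  k%:R * (s%:R / 2 * ((k%:R + y%:R) / (s + b)%:R) / (k + a)%:R) =
  k%:R / (k + a)%:R / 2 * (a%:R + b%:R / (s + b)%:R * (k + y)%:R) :> R.
Proof.
move=> b0 a0.
have sb0 : 0 < s%:R + b%:R :> R by rewrite -natrD ltr0n addn_gt0 b0 orbT.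
have ka0 : 0 < k%:R + a%:R :> R by rewrite -natrD ltr0n addn_gt0 a0 orbT.
by rewrite !natrD; field; rewrite !lt0r_neq0.
Qed.

(** This is the integrand left in one row after Stein's identity: the first shifted gain comes from
    [N_i], the second from [Y_i]. Their part of degree one in [a] and [t1] dominates the subtracted
    linear term, and the quadratic parts give the bound. *)
Lemma shrink_gain_ge (k y a b s : nat) :
  (3 <= a)%N -> (0 < b)%N -> (k + y <= s)%N ->
  ((k + y).+1%:R^-1 - b%:R ^+ 2 / (s.+1 + b)%:R ^+ 2 * (k + y).+1%:R) / 2 <=
  shrink_gain k.+1 y a b s.+1 + shrink_gain k y.+1 a b s.+1
  - k%:R / (k + a)%:R * (a%:R + b%:R / (s + b)%:R * (k + y)%:R) :> R.
Proof.
move=> a3 b0; rewrite /shrink_gain [(k.+1 + y)%N]addSn addnS.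
move: (k + y)%N => z zs.
pose e0 : R := k%:R / (k + a)%:R; pose e1 : R := k.+1%:R / (k.+1 + a)%:R.
pose t0 : R := b%:R / (s + b)%:R; pose t1 : R := b%:R / (s.+1 + b)%:R.
pose H := (e0 + e1) / 2.
have a3R : 3 <= a%:R :> R by rewrite ler_nat.
have a0R : 0 < a%:R :> R by rewrite ltr0n (leq_trans _ a3).
have k0 : 0 <= k%:R :> R by [].
have ka0 : 0 < k%:R + a%:R :> R by rewrite ltr_wpDl.
have e00 : 0 <= e0 by rewrite divr_ge0.
have e01 : e0 <= e1.
  rewrite /e0 /e1 !natrD -natr1 ler_pdivrMr// mulrAC ler_pdivlMr; last by lra.
  by nra.
have e11 : e1 <= 1 by rewrite /e1 ler_pdivrMr ?mul1r ?ler_nat ?leq_addr.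
(* At [k = 0] this reads [2 * (a + 1) <= a ^+ 2], true for [a = 3] and false for [a = 2]: hence the
   requirement of four entries per row. *)
have e1a : 1 <= e1 / 2 * a%:R ^+ 2.
  rewrite /e1 natrD -natr1 mulrAC ler_pdivlMr// mulrAC ler_pdivlMr; last by lra.
  have a2 : 3 * a%:R <= a%:R ^+ 2 :> R by rewrite expr2 ler_wpM2r// ltW.
  have ka2 : k%:R * (3 * 3) <= k%:R * a%:R ^+ 2 :> R by rewrite ler_wpM2l//; lra.
  lra.
have t00 : 0 <= t0 by rewrite divr_ge0.
have t10 : 0 <= t1 by rewrite divr_ge0.
have w0 : 0 < z.+1%:R :> R by [].
(* After cross-multiplication this is [z <= s + b]. *)
have tz : t0 * z%:R <= t1 * z.+1%:R.
  have sb0 : 0 < s%:R + b%:R :> R by rewrite -natrD ltr0n addn_gt0 b0 orbT.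
  have zsR : z%:R <= s%:R :> R by rewrite ler_nat.
  rewrite /t0 /t1 mulrAC [leRHS]mulrAC !natrD -[s.+1%:R]natr1 -[z.+1%:R]natr1.
  rewrite ler_pdivrMr// [leRHS]mulrAC ler_pdivlMr; last by lra.
  have b0R : 0 <= b%:R :> R by [].
  by rewrite -!mulrA ler_wpM2l//; lra.
have -> : b%:R ^+ 2 / (s.+1 + b)%:R ^+ 2 = t1 ^+ 2 :> R.
  by rewrite /t1 expr_div_n.
rewrite -/e0 -/e1 -/t0 -/t1.
have w1 : 0 < z.+1%:R^-1 :> R by rewrite invr_gt0.
have tz0 : 0 <= t0 * z%:R by rewrite mulr_ge0.
move: z%:R z.+1%:R z.+1%:R^-1 w0 w1 tz tz0 => x w v w0 v0 tz tz0.
have H0 : e0 <= H by rewrite /H; lra.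
have H1 : H <= 1 by rewrite /H; lra.
have Ha : 1 <= H * a%:R ^+ 2.
  by apply: le_trans e1a _; rewrite ler_wpM2r ?exprn_ge0// /H; lra.
have -> : e1 / 4 * (2 * a%:R + a%:R ^+ 2 * v + 2 * t1 * w - t1 ^+ 2 * w) +
    e0 / 4 * (2 * a%:R + a%:R ^+ 2 * v + 2 * t1 * w - t1 ^+ 2 * w) =
    H * (a%:R + t1 * w) + H * a%:R ^+ 2 * v / 2 - H * (t1 ^+ 2 * w) / 2.
  by rewrite /H; field.
have A1 : e0 * (a%:R + t0 * x) <= H * (a%:R + t1 * w).
  by apply: ler_pM; rewrite ?addr_ge0// ?lerD2l// ltW.
have A2 : v <= H * a%:R ^+ 2 * v by rewrite -[leLHS]mul1r ler_wpM2r// ltW.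
have A3 : H * (t1 ^+ 2 * w) <= t1 ^+ 2 * w.
  by rewrite -[leRHS]mul1r ler_wpM2r// mulr_ge0 ?exprn_ge0// ltW.
lra.
Qed.

(* Tangent line of [x |-> 1 / x] at the mean [W / m] of the weights. *)
Lemma sum_inv_gt (m : nat) (w : 'I_m -> R) (W : R) : (0 < m)%N ->
  (forall i, 0 < w i) -> \sum_i w i = W ->
  0 < \sum_i ((w i)^-1 - m.-1%:R ^+ 2 / W ^+ 2 * w i).
Proof.
case: m w => // m w _ w0 wW /=; have W0 : 0 < W.
  rewrite -wW (bigD1 ord0)//= ltr_wpDr//.
  by apply: sumr_ge0 => i _; exact: ltW.
pose p := m.+1%:R / W.
apply: (@lt_le_trans _ _ (\sum_i (2 * p - (p ^+ 2 + m%:R ^+ 2 / W ^+ 2) * w i))).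
  rewrite sumrB sumr_const card_ord -mulr_sumr wW -[_ *+ m.+1]mulr_natr /p.
  have -> : 2 * (m.+1%:R / W) * m.+1%:R -
     ((m.+1%:R / W) ^+ 2 + m%:R ^+ 2 / W ^+ 2) * W =
     (m.+1%:R ^+ 2 - m%:R ^+ 2) / W by field; rewrite lt0r_neq0.
  by rewrite divr_gt0// subr_gt0 ltrXn2r// ?nnegrE// ltr_nat.
apply: ler_sum => i _; rewrite -subr_ge0.
have -> : (w i)^-1 - m%:R ^+ 2 / W ^+ 2 * w i -
  (2 * p - (p ^+ 2 + m%:R ^+ 2 / W ^+ 2) * w i) = (1 - p * w i) ^+ 2 / w i.
  by field; rewrite !lt0r_neq0.
by rewrite divr_ge0 ?sqr_ge0 ?ltW.
Qed.

End Algebra.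

(** * Row counts and the effect of a unit shift on them *)

Section RowCounts.
Context {m : nat} {n : 'I_m -> nat}.

Local Notation index := ({i : 'I_m & 'I_(n i)} + 'I_m)%type.
Implicit Types (z : {ffun index -> nat}) (i : 'I_m) (u : 'I_m -> nat).

Definition x_part z : array n nat :=
  fun i j => z (inl (Tagged (fun i => 'I_(n i)) j)).
Definition y_part z i : nat := z (inr i).
Definition rows z i : nat := row_count (x_part z) i.

Definition add_unit i u : 'I_m -> nat := fun l => (u l + (l == i))%N.

Lemma add_unit_id i u : add_unit i u i = (u i).+1.
Proof. by rewrite /add_unit eqxx addn1. Qed.

Lemma sum_add_unit i u : (\sum_l add_unit i u l = (\sum_l u l).+1)%N.
Proof.
rewrite big_split /= [X in (_ + X)%N](bigD1 i)//= eqxx.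
by rewrite [X in (_ + (_ + X))%N]big1 ?addn0 ?addn1// => l /negbTE ->.
Qed.

(** The result does not depend on [j], so the Stein identities of the entries of a row add up to one
    for the row count. *)
Lemma rows_incr_inl i (j : 'I_(n i)) z :
  rows (incr (inl (Tagged (fun i => 'I_(n i)) j)) z) = add_unit i (rows z).
Proof.
apply/funext => l; rewrite /rows /row_count /x_part /add_unit.
under eq_bigr do rewrite ffunE.
rewrite big_split /=; congr addn.
have [->|li] := eqVneq l i.
  rewrite (bigD1 j)//= eqxx big1 ?addn0// => k /negbTE kj.
  apply/eqP; rewrite eqb0; apply: contraFN kj => /eqP[] /eqP.
  by rewrite eq_Tagged.
rewrite big1// => k _; apply/eqP; rewrite eqb0; apply: contra li.
by move=> /eqP/(congr1 (fun k => if k is inl p then tag p else l))/= ->.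
Qed.

Lemma y_part_incr_inl (p : {i : 'I_m & 'I_(n i)}) z :
  y_part (incr (inl p) z) = y_part z.
Proof. by apply/funext => l; rewrite /y_part ffunE addn0. Qed.

Lemma x_part_incr_inl i (j : 'I_(n i)) z :
  x_part (incr (inl (Tagged (fun i => 'I_(n i)) j)) z) j = (x_part z j).+1.
Proof. by rewrite /x_part ffunE eqxx addn1. Qed.

Lemma rows_incr_inr i z : rows (incr (inr i) z) = rows z.
Proof.
by apply/funext => l; apply: eq_bigr => k _; rewrite /x_part ffunE addn0.
Qed.

Lemma y_part_incr_inr i z : y_part (incr (inr i) z) = add_unit i (y_part z).
Proof. by apply/funext => l; rewrite /y_part /add_unit ffunE. Qed.

End RowCounts.

(** * Risk of estimators that rescale each row *)

Section Risk.
Context {R : realType} {m : nat} {n : 'I_m -> nat}.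
Hypothesis n_gt0 : forall i, (0 < n i)%N.
Context {d : measure_display} {T : measurableType d} (P : probability T R).
Variables (X : array n {mfun T >-> nat}) (Y : 'I_m -> {mfun T >-> nat}).
Arguments X : clear implicits.
Variable lam : array n R.
Arguments lam : clear implicits.
Hypothesis lam_gt0 : param_space lam.
Hypothesis X_poisson : forall i j, poisson_distributed P (X i j) (lam i j).
Hypothesis Y_poisson : forall i, poisson_distributed P (Y i) (row_sum lam i).
Hypothesis XY_indep : mutually_independent P (observations X Y).

Local Notation index := ({i : 'I_m & 'I_(n i)} + 'I_m)%type.
Local Notation L := (row_sum lam).
Local Notation counts := (('I_m -> nat) -> ('I_m -> nat) -> R).
Implicit Types (z : {ffun index -> nat}) (i : 'I_m) (G : counts).

Lemma row_sum_gt0 i : 0 < L i.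
Proof.
rewrite /row_sum (bigD1 (Ordinal (n_gt0 i)))//= ltr_wpDr// ?lam_gt0//.
by apply: sumr_ge0 => j _; rewrite ltW ?lam_gt0.
Qed.

Let mean_gt0 k : 0 < observations lam L k.
Proof. by case: k => [[i j]|i]; [exact: lam_gt0|exact: row_sum_gt0]. Qed.

Let obs_poisson k :
  poisson_distributed P (observations X Y k) (observations lam L k).
Proof. by case: k => [[i j]|i]; [exact: X_poisson|exact: Y_poisson]. Qed.

Local Notation expect := (expect P (observations X Y)).

Definition tame G : Prop :=
  poly_growth (fun z : {ffun index -> nat} => G (rows z) (y_part z)).

Definition Ex G : R := expect (fun z => G (rows z) (y_part z)).

Lemma tame_row i : tame (fun N _ => (N i)%:R).
Proof.
apply: poly_growth_le (poly_growth_sum (index_enum 'I_(n i))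
  (fun j => poly_growth_coord (inl (Tagged (fun i => 'I_(n i)) j)))) => z.
by rewrite natr_sum.
Qed.

Lemma tame_y i : tame (fun _ Y => (Y i)%:R).
Proof. exact: poly_growth_coord. Qed.

(** Summing the identity over the entries of the row gives the one for [N_i] without computing the
    law of a sum of Poisson variables. *)
Lemma Ex_stein_row i G : tame G ->
  Ex (fun N Y => (N i)%:R * G N Y) = L i * Ex (fun N Y => G (add_unit i N) Y).
Proof.
move=> tG.
transitivity (\sum_(j < n i) expect (fun z => (x_part z j)%:R *
    G (rows z) (y_part z))).
  rewrite -(expect_sum mean_gt0 obs_poisson XY_indep); last first.
    by move=> j; apply: poly_growthM => //; exact: poly_growth_coord.
  by apply: eq_expect => z; rewrite -mulr_suml -natr_sum.
rewrite mulr_suml; apply: eq_bigr => j _.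
rewrite (poisson_stein mean_gt0 obs_poisson XY_indep)//=; congr (_ * _).
by apply: eq_expect => z /=; rewrite rows_incr_inl y_part_incr_inl.
Qed.

Lemma Ex_stein_y i G : tame G ->
  Ex (fun N Y => (Y i)%:R * G N Y) = L i * Ex (fun N Y => G N (add_unit i Y)).
Proof.
move=> tG; rewrite /Ex (poisson_stein mean_gt0 obs_poisson XY_indep)//=.
congr (_ * _).
by apply: eq_expect => z /=; rewrite rows_incr_inr y_part_incr_inr.
Qed.

(** The square expands into [C ^+ 2 * x ^+ 2 / lam - 2 * C * x + lam]. Stein's identity in each
    entry removes the division by [lam i j]; the sum over [j] depends on row counts only, and the
    row identity read backwards brings in [L i]. *)
Lemma expect_loss (C : 'I_m -> counts) : (forall i, tame (C i)) ->
  expect (fun z => loss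
    (fun i j => C i (rows z) (y_part z) * (x_part z j)%:R) lam) =
  \sum_i (Ex (fun N Y => (N i)%:R * (C i N Y ^+ 2 * ((N i)%:R + (n i).-1%:R)))
            / L i
          - 2 * Ex (fun N Y => (N i)%:R * C i N Y) + L i).
Proof.
move=> tC.
have eS := expect_sum mean_gt0 obs_poisson XY_indep.
have eD := expectD mean_gt0 obs_poisson XY_indep.
have eZ := expectZ mean_gt0 obs_poisson XY_indep.
have pg_x i (j : 'I_(n i)) : poly_growth (fun z => (x_part z j)%:R : R).
  exact: poly_growth_coord.
have tC2 i : tame (fun N Y => C i N Y ^+ 2) by exact: (poly_growthX 2 (tC i)).
have tC' i (j : 'I_(n i)) :
    poly_growth (fun z => C i (add_unit i (rows z)) (y_part z) ^+ 2).
  apply: poly_growth_le (poly_growth_incr (inl (Tagged _ j)) (tC2 i)) => z /=.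
  by rewrite rows_incr_inl y_part_incr_inl.
rewrite /loss eS; last first.
  move=> i; apply: poly_growth_sum => j; apply: poly_growthM (poly_growth_cst _).
  by apply/poly_growthX/poly_growthB/poly_growth_cst;
    exact: poly_growthM (tC i) (pg_x i j).
apply: eq_bigr => i _; rewrite eS; last first.
  move=> j; apply: poly_growthM (poly_growth_cst _).
  by apply/poly_growthX/poly_growthB/poly_growth_cst;
    exact: poly_growthM (tC i) (pg_x i j).
have eqj j : expect (fun z => (C i (rows z) (y_part z) * (x_part z j)%:R -
      lam i j) ^+ 2 / lam i j) =
    expect (fun z =>
      C i (add_unit i (rows z)) (y_part z) ^+ 2 * ((x_part z j)%:R + 1))
    + (- 2) * expect (fun z => (x_part z j)%:R * C i (rows z) (y_part z))
    + lam i j.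
  have l0 := lam_gt0 j.
  have := poisson_stein mean_gt0 obs_poisson XY_indep
    (inl (Tagged _ j)) (poly_growthM (tC2 i) (pg_x i j)) => /=.
  have -> : expect ((fun z => C i (rows z) (y_part z) ^+ 2 * (x_part z j)%:R) \o
      incr (inl (Tagged _ j))) =
    expect (fun z =>
      C i (add_unit i (rows z)) (y_part z) ^+ 2 * ((x_part z j)%:R + 1)).
    apply: eq_expect => z /=.
    by rewrite rows_incr_inl y_part_incr_inl x_part_incr_inl -natr1.
  move=> E2.
  transitivity (expect (fun z => (lam i j)^-1 *
      ((x_part z j)%:R * (C i (rows z) (y_part z) ^+ 2 * (x_part z j)%:R)) +
      (- 2) * ((x_part z j)%:R * C i (rows z) (y_part z)) + lam i j)).
    by apply: eq_expect => z; field; rewrite lt0r_neq0.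
  have pB := poly_growthM (pg_x i j) (tC i).
  have pA := poly_growthM (pg_x i j) (poly_growthM (tC2 i) (pg_x i j)).
  have pA' := poly_growthM (poly_growth_cst (lam i j)^-1) pA.
  have pB' := poly_growthM (poly_growth_cst (- 2)) pB.
  rewrite (eD _ _ (poly_growthD pA' pB') (poly_growth_cst _)) (eD _ _ pA' pB').
  by rewrite !eZ// expect_cst E2 mulKf// lt0r_neq0.
rewrite (eq_bigr _ (fun j _ => eqj j)) !big_split /= -mulr_sumr.
have pA j := poly_growthM (tC' i j) (poly_growthD (pg_x i j) (poly_growth_cst 1)).
have pB j := poly_growthM (pg_x i j) (tC i).
rewrite -[X in X + _ * _](eS _ _ _ pA) -[X in _ * X](eS _ _ _ pB) mulNr.
rewrite Ex_stein_row; last first.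
  apply: poly_growthM (tC2 i) _.
  exact: poly_growthD (tame_row i) (poly_growth_cst _).
rewrite [X in _ = X - _ + _]mulrC mulKf ?lt0r_neq0 ?row_sum_gt0//.
congr (_ - _ * _ + _).
  (* The sum of [x + 1] over the row is [N_i + n_i], regrouped as [(N_i + 1) + (n_i - 1)] to match
     the shifted row count. *)
  apply: eq_expect => z; rewrite -mulr_sumr big_split /= sumr_const card_ord.
  rewrite -natr_sum add_unit_id -natr1 -addrA; congr (_ * (_ + _)).
  by rewrite nat1r prednK.
by apply: eq_expect => z; rewrite -mulr_suml -natr_sum.
Qed.

Lemma eq_Ex F G : (forall N Y, F N Y = G N Y) -> Ex F = Ex G.
Proof. by move=> FG; apply: eq_expect => z; exact: FG. Qed.

Lemma ExD F G : tame F -> tame G ->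
  Ex (fun N Y => F N Y + G N Y) = Ex F + Ex G.
Proof. exact: (expectD mean_gt0 obs_poisson XY_indep). Qed.

Lemma ExB F G : tame F -> tame G ->
  Ex (fun N Y => F N Y - G N Y) = Ex F - Ex G.
Proof. exact: (expectB mean_gt0 obs_poisson XY_indep). Qed.

Lemma ExZ c G : tame G -> Ex (fun N Y => c * G N Y) = c * Ex G.
Proof. exact: (expectZ mean_gt0 obs_poisson XY_indep). Qed.

Lemma Ex_sum I (r : seq I) (F : I -> counts) : (forall k, tame (F k)) ->
  Ex (fun N Y => \sum_(k <- r) F k N Y) = \sum_(k <- r) Ex (F k).
Proof.
have eS := expect_sum mean_gt0 obs_poisson XY_indep.
exact: (eS _ r (fun k z => F k (rows z) (y_part z))).
Qed.

Lemma le_Ex F G : tame F -> tame G ->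
  (forall N Y, F N Y <= G N Y) -> Ex F <= Ex G.
Proof.
by move=> tF tG FG; exact: (le_expect mean_gt0 obs_poisson XY_indep).
Qed.

Lemma Ex_gt0 F : tame F -> (forall N Y, 0 < F N Y) -> 0 < Ex F.
Proof.
by move=> tF F0; apply: (expect_gt0 mean_gt0 obs_poisson XY_indep).
Qed.

Definition row_risk i (c : counts) : R :=
  Ex (fun N Y => (N i)%:R * (c N Y ^+ 2 * ((N i)%:R + (n i).-1%:R))) / L i
  - 2 * Ex (fun N Y => (N i)%:R * c N Y) + L i.

Lemma row_riskB i (c c' : counts) :
  tame c -> tame c' ->
  row_risk i c - row_risk i c' =
  Ex (fun N Y => (N i)%:R * (c N Y ^+ 2 * ((N i)%:R + (n i).-1%:R)) -
    (N i)%:R * (c' N Y ^+ 2 * ((N i)%:R + (n i).-1%:R))) / L i -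
  2 * Ex (fun N Y => (N i)%:R * c N Y - (N i)%:R * c' N Y).
Proof.
move=> tc tc'; have tN := tame_row i.
have tq b : tame b ->
    tame (fun N Y => (N i)%:R * (b N Y ^+ 2 * ((N i)%:R + (n i).-1%:R))).
  move=> tb; apply: poly_growthM => //; apply: poly_growthM.
    exact: (poly_growthX 2 tb).
  exact: poly_growthD tN (poly_growth_cst _).
have tl b : tame b -> tame (fun N Y => (N i)%:R * b N Y).
  by move=> tb; exact: poly_growthM.
rewrite ExB; [|exact: tq..]; rewrite ExB; [|exact: tl..].
by rewrite /row_risk; ring.
Qed.

(** All risks are thereby finite, and dominance becomes a comparison of real sums, row by row. *)
Lemma risk_multiplier (delta : estimator R n) (c : 'I_m -> counts) :
  (forall i, tame (c i)) ->
  (forall x y i j, delta x y i j = c i (row_count x) y * (x i j)%:R) ->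
  ('E_P[fun t : T =>
     loss (delta (fun i j => X i j t) (fun i => Y i t)) lam] =
   (\sum_i row_risk i (c i))%:E)%E.
Proof.
move=> tc deltaE; rewrite -(expect_loss tc).
rewrite -(expectationE mean_gt0 obs_poisson XY_indep); last first.
  apply: poly_growth_sum => i; apply: poly_growth_sum => j.
  apply: poly_growthM (poly_growth_cst _).
  apply/poly_growthX/poly_growthB/poly_growth_cst.
  exact: poly_growthM (tc i) (poly_growth_coord _).
congr expectation; apply/funext => t /=.
apply: eq_bigr => i _; apply: eq_bigr => j _; rewrite deltaE.
have -> : (fun i (j : 'I_(n i)) => X i j t) =
    x_part [ffun k => observations X Y k t].
  by apply/functional_extensionality_dep => l; apply/funext => k;
    rewrite /x_part ffunE.
have -> : (fun i => Y i t) = y_part [ffun k => observations X Y k t].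
  by apply/funext => l; rewrite /y_part ffunE.
by rewrite /x_part ffunE.
Qed.

Definition mult_ML i : counts := fun N Y => ((N i)%:R + (Y i)%:R) / 2 / (N i)%:R.

Definition mult_O i : counts := fun N Y =>
  ((N i)%:R + (Y i)%:R + (n i).-1%:R) / 2 / (N i + (n i).-1)%:R.

Definition total (N Y : 'I_m -> nat) : nat := (\sum_l N l + \sum_l Y l)%N.

Definition mult_hat i : counts := fun N Y =>
  (total N Y)%:R / 2 * (((N i)%:R + (Y i)%:R) / (total N Y + m.-1)%:R)
  / (N i + (n i).-1)%:R.

Lemma tame_cst c : tame (fun _ _ => c).
Proof. exact: poly_growth_cst. Qed.

Lemma tame_inv (u : ('I_m -> nat) -> ('I_m -> nat) -> nat) :
  tame (fun N Y => (u N Y)%:R^-1).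
Proof. exact: poly_growth_invn. Qed.

Lemma tame_bool (u : ('I_m -> nat) -> ('I_m -> nat) -> bool) :
  tame (fun N Y => (u N Y)%:R).
Proof. exact: poly_growth_bool. Qed.

Lemma tameD F G : tame F -> tame G -> tame (fun N Y => F N Y + G N Y).
Proof. exact: poly_growthD. Qed.

Lemma tameB F G : tame F -> tame G -> tame (fun N Y => F N Y - G N Y).
Proof. exact: poly_growthB. Qed.

Lemma tameX F k : tame F -> tame (fun N Y => F N Y ^+ k).
Proof. exact: poly_growthX. Qed.

Lemma tameM F G : tame F -> tame G -> tame (fun N Y => F N Y * G N Y).
Proof. exact: poly_growthM. Qed.

Lemma tame_mult_ML i : tame (mult_ML i).
Proof.
by apply: tameM (tame_inv _); apply: tameM (tame_cst _); apply: tameD;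
  [exact: tame_row|exact: tame_y].
Qed.

Lemma tame_mult_O i : tame (mult_O i).
Proof.
apply: tameM (tame_inv _); apply: tameM (tame_cst _); apply: tameD (tame_cst _).
by apply: tameD; [exact: tame_row|exact: tame_y].
Qed.

Lemma tame_total : tame (fun N Y => (total N Y)%:R).
Proof.
apply: (@poly_growth_le _ _ _
  (fun z => \sum_l (rows z l)%:R + \sum_l (y_part z l)%:R)).
  by move=> z; rewrite natrD !natr_sum.
by apply: poly_growthD; apply: poly_growth_sum => l; [exact: tame_row|exact: tame_y].
Qed.

Lemma tame_mult_hat i : tame (mult_hat i).
Proof.
apply: tameM (tame_inv _); apply: tameM.
  by apply: tameM (tame_cst _); exact: tame_total.
by apply: tameM (tame_inv _); apply: tameD; [exact: tame_row|exact: tame_y].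
Qed.

(** The row is nonempty, so the shift of its count is realised by incrementing its first entry. *)
Lemma tame_add_unit_row i G : tame G -> tame (fun N Y => G (add_unit i N) Y).
Proof.
move=> tG; pose j := Tagged (fun i => 'I_(n i)) (Ordinal (n_gt0 i)).
apply: poly_growth_le (poly_growth_incr (inl j) tG) => z /=.
by rewrite rows_incr_inl y_part_incr_inl.
Qed.

Lemma tame_add_unit_y i G : tame G -> tame (fun N Y => G N (add_unit i Y)).
Proof.
move=> tG; apply: poly_growth_le (poly_growth_incr (inr i) tG) => z /=.
by rewrite rows_incr_inr y_part_incr_inr.
Qed.

(** * Comparison of the ML estimator with [lambda_O] *)

Let U i : R := Ex (fun N _ => (0 < N i)%:R).
(** As [0^-1 = 0], the indicator of [0 < N i] is implicit here; in [B] it must be written, since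
    [N i + (n i).-1] can be positive at [N i = 0]. *)
Let A i : R := Ex (fun N _ => (N i)%:R^-1).
Let B i : R := Ex (fun N _ => (0 < N i)%:R * (N i + (n i).-1)%:R^-1).

Let tame_pos i : tame (fun N _ => (0 < N i)%:R).
Proof. exact: (tame_bool (fun N _ => 0 < N i)%N). Qed.

Let tame_posV i k : tame (fun N _ => (0 < N i)%:R * (N i + k)%:R^-1).
Proof. exact: (tameM (tame_pos i) (tame_inv (fun N _ => N i + k)%N)). Qed.

Let tame_rowV i : tame (fun N _ => (N i)%:R^-1).
Proof. exact: (tame_inv (fun N _ => N i)). Qed.

(** Stein's identity in [Y_i] is used twice on the quadratic part, which has degree two in [Y_i],
    and once on the linear part. *)
Lemma row_risk_ML_O i :
  row_risk i (mult_ML i) - row_risk i (mult_O i) =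
  (n i).-1%:R * (U i / 2 + (L i + 1) / 4 * (A i + B i) - L i * B i).
Proof.
have L0 := row_sum_gt0 i; have tY := tame_y i.
rewrite row_riskB; [|exact: tame_mult_ML|exact: tame_mult_O].
set a : R := (n i).-1%:R.
pose h : counts := fun N _ => (N i)%:R^-1 + (0 < N i)%:R * (N i + (n i).-1)%:R^-1.
have th : tame h by exact: tameD (tame_rowV i) (tame_posV i _).
have tg : tame (fun N Y => 2 * (0 < N i)%:R + (Y i)%:R * h N Y).
  by apply: tameD; apply: tameM => //; exact: tame_cst.
rewrite (eq_Ex (G := fun N Y =>
    (Y i)%:R * (a / 4 * (2 * (0 < N i)%:R + (Y i)%:R * h N Y)))); last first.
  by move=> N Y'; rewrite /mult_ML /mult_O quad_ML_O.
rewrite Ex_stein_y; last by apply: tameM tg; exact: tame_cst.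
rewrite (eq_Ex (G := fun N Y => a / 4 *
    (2 * (0 < N i)%:R + (Y i)%:R * h N Y + h N Y))); last first.
  by move=> N Y'; rewrite add_unit_id -natr1 /h; ring.
rewrite ExZ; last exact: tameD.
rewrite ExD// ExD; [|exact: tameM (tame_cst _) (tame_pos i)|exact: tameM].
rewrite ExZ// Ex_stein_y// -/(Ex h).
rewrite [X in _ - 2 * X](eq_Ex (G := fun N Y =>
    a / 2 * ((Y i)%:R * ((0 < N i)%:R * (N i + (n i).-1)%:R^-1)))); last first.
  by move=> N Y'; rewrite /mult_ML /mult_O lin_ML_O.
rewrite ExZ; last exact: tameM.
rewrite Ex_stein_y// -/(B i).
have -> : Ex h = A i + B i by rewrite /h ExD.
by rewrite -/(U i); field; rewrite lt0r_neq0.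
Qed.

Lemma row_risk_O_lt_ML i : (1 < n i)%N ->
  row_risk i (mult_O i) < row_risk i (mult_ML i).
Proof.
move=> n1; have L0 := row_sum_gt0 i.
have a0 : (0 < (n i).-1)%N by rewrite -ltnS prednK.
pose C := Ex (fun N _ => (0 < N i)%:R * (N i + 1)%:R^-1).
have AC : C <= A i.
  apply: le_Ex => // N _; case: (N i) => [|k]; first by rewrite mul0r invr0.
  by rewrite mul1r lef_pV2 ?posrE// ler_nat addn1.
have CB : B i <= C.
  apply: le_Ex => // N _; case: (N i) => [|k]; first by rewrite !mul0r.
  rewrite !mul1r lef_pV2 ?posrE ?addnS// ler_nat !addSn ltnS addn0.
  by rewrite -addn1 leq_add2l.
have LC : L i * C <= U i.
  (* Shifting [f] gives the integrand of [C], while [N i * f] is the indicator of [1 < N i]. *)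
  pose f : counts := fun N _ => (1 < N i)%:R * (N i)%:R^-1.
  have tf : tame f.
    exact: tameM (tame_bool (fun N _ => 1 < N i)%N) (tame_rowV i).
  have -> : C = Ex (fun N Y => f (add_unit i N) Y).
    by apply: eq_Ex => N Y'; rewrite /f add_unit_id addn1.
  rewrite -Ex_stein_row//; apply: le_Ex => //; first exact: tameM (tame_row i) tf.
  move=> N Y'; rewrite /f; case: (N i) => [|[|k]]; rewrite ?mul0r ?mulr0 ?ler01//.
  by rewrite mul1r divff.
have B0 : 0 < B i.
  (* The integrand of [B i] vanishes at [N i = 0]; rewritten as [N i * f], it becomes after the
     shift a function positive everywhere. *)
  pose f : counts := fun N _ => (N i)%:R^-1 * (N i + (n i).-1)%:R^-1.
  have tf : tame f.
    exact: (tameM (tame_rowV i) (tame_inv (fun N _ => N i + (n i).-1)%N)).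
  have -> : B i = L i * Ex (fun N Y => f (add_unit i N) Y).
    rewrite -Ex_stein_row//; apply: eq_Ex => N Y'; rewrite /f mulrA.
    by case: (N i) => [|k]; rewrite ?mul0r// divff.
  rewrite mulr_gt0//; apply: Ex_gt0 => [|N Y'].
    apply: tameM (tame_inv (fun N _ => add_unit i N i)) _.
    exact: (tame_inv (fun N _ => add_unit i N i + (n i).-1)%N).
  by rewrite /f add_unit_id mulr_gt0 ?invr_gt0.
rewrite -subr_gt0 row_risk_ML_O mulr_gt0 ?ltr0n//.
(* With [D1], [D2] and [LC] the bracket is at least [L B / 2 + (L + 1) B / 2 - L B = B / 2]. *)
have D1 : 0 <= (L i + 1) * (A i - B i) by rewrite mulr_ge0; lra.
have D2 : L i * B i <= L i * C by rewrite ler_wpM2l// ltW.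
lra.
Qed.

Lemma row_risk_O_le_ML i : row_risk i (mult_O i) <= row_risk i (mult_ML i).
Proof.
have [n1|n1] := leqP (n i) 1; last exact/ltW/row_risk_O_lt_ML.
rewrite -subr_ge0 row_risk_ML_O.
have -> : (n i).-1 = 0%N by apply/eqP; rewrite -subn1 subn_eq0.
by rewrite mul0r.
Qed.

(** * Comparison of [lambda_O] with [lambda_hat] *)

Lemma sum_row_risk_O_hat : (1 < m)%N -> (forall i, (4 <= n i)%N) ->
  \sum_i row_risk i (mult_hat i) < \sum_i row_risk i (mult_O i).
Proof.
move=> m1 n4; have b0 : (0 < m.-1)%N by rewrite -ltnS prednK// ltnW.
have a3 i : (3 <= (n i).-1)%N by rewrite -ltnS prednK.
pose g i : counts := fun N Y =>
  shrink_gain (N i) (Y i) (n i).-1 m.-1 (total N Y).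
pose l i : counts := fun N Y => (N i)%:R / (N i + (n i).-1)%:R *
  ((n i).-1%:R + m.-1%:R / (total N Y + m.-1)%:R * (N i + Y i)%:R).
have total_addN i N Y' : total (add_unit i N) Y' = (total N Y').+1.
  by rewrite /total sum_add_unit.
have total_addY i N Y' : total N (add_unit i Y') = (total N Y').+1.
  by rewrite /total sum_add_unit addnS.
have tN i : tame (fun N Y => (N i + Y i)%:R).
  apply: poly_growth_le (tameD (tame_row i) (tame_y i)) => z.
  by rewrite natrD.
have tf i : tame (fun N Y => (N i)%:R / (N i + (n i).-1)%:R).
  exact: tameM (tame_row i) (tame_inv (fun N _ => N i + (n i).-1)%N).
have tt : tame (fun N Y => m.-1%:R / (total N Y + m.-1)%:R).
  exact: tameM (tame_cst _) (tame_inv _).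
have tl i : tame (l i).
  apply: tameM => //; apply: tameD; first exact: tame_cst.
  exact: tameM.
have tg i : tame (g i).
  apply: tameM; first exact: tameM (tf i) (tame_cst _).
  apply: tameB; last exact: tameM (tameX 2 tt) (tN i).
  apply: tameD; last by apply: tameM (tN i); exact: tameM (tame_cst _) tt.
  apply: tameD; first exact: tame_cst.
  exact: tameM (tame_cst _) (tame_inv (fun N Y => N i + Y i)%N).
(* The factor [L i] produced by Stein's identity cancels the division in the row risk, so [D i] is
   free of the parameter and its sum over [i] can be bounded outcome by outcome. *)
pose D i : counts := fun N Y =>
  g i (add_unit i N) Y + g i N (add_unit i Y) - l i N Y.
have tgN i : tame (fun N Y => g i (add_unit i N) Y) by exact: tame_add_unit_row.
have tgY i : tame (fun N Y => g i N (add_unit i Y)) by exact: tame_add_unit_y.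
have tD i : tame (D i) by exact: tameB (tameD (tgN i) (tgY i)) (tl i).
have diffE i : row_risk i (mult_O i) - row_risk i (mult_hat i) = Ex (D i).
  have L0 := row_sum_gt0 i.
  rewrite row_riskB; [|exact: tame_mult_O|exact: tame_mult_hat].
  rewrite (eq_Ex (G := fun N Y =>
      (N i)%:R * g i N Y + (Y i)%:R * g i N Y)); last first.
    move=> N Y'; rewrite /mult_O /mult_hat quad_O_hat//.
    exact: leq_trans (a3 i).
  rewrite ExD; [|exact: tameM (tame_row i) (tg i)|exact: tameM (tame_y i) (tg i)].
  rewrite Ex_stein_row// Ex_stein_y//.
  rewrite [X in _ - 2 * X](eq_Ex (G := fun N Y => 2^-1 * l i N Y)); last first.
    move=> N Y'; rewrite /mult_O /mult_hat lin_O_hat//; last exact: leq_trans (a3 i).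
    by rewrite /l; ring.
  rewrite ExZ// /D ExB//; last exact: tameD.
  by rewrite ExD//; field; rewrite lt0r_neq0.
rewrite -subr_gt0 -sumrB (eq_bigr _ (fun i _ => diffE i)) -Ex_sum//.
apply: Ex_gt0; first exact: poly_growth_sum.
move=> N Y'.
pose w i : R := (N i + Y' i).+1%:R.
(* The shifted denominator equals [total N Y' + m], which is exactly the sum of the [w i]. *)
pose W : R := ((total N Y').+1 + m.-1)%:R.
apply: (@lt_le_trans _ _ (\sum_i ((w i)^-1 - m.-1%:R ^+ 2 / W ^+ 2 * w i) / 2)).
  rewrite -mulr_suml mulr_gt0 ?invr_gt0//.
  apply: sum_inv_gt => //; first exact: ltnW.
  rewrite -natr_sum; congr (_%:R); rewrite /total -big_split /=.
  under eq_bigr do rewrite -addn1; rewrite big_split /= sum_nat_const card_ord.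
  by rewrite muln1 addSnnS prednK// ltnW.
apply: ler_sum => i _.
rewrite /D /g total_addN total_addY !add_unit_id.
apply: shrink_gain_ge => //.
rewrite /total (bigD1 i)//= [X in (_ <= _ + X)%N](bigD1 i)//=.
lia.
Qed.

Lemma sum_row_risk_O_le_ML :
  \sum_i row_risk i (mult_O i) <= \sum_i row_risk i (mult_ML i).
Proof. by apply: ler_sum => i _; exact: row_risk_O_le_ML. Qed.

Lemma sum_row_risk_O_lt_ML : (2 <= \max_(i < m) n i)%N ->
  \sum_i row_risk i (mult_O i) < \sum_i row_risk i (mult_ML i).
Proof.
move=> max2; have [i ni] : exists i, (1 < n i)%N.
  apply/existsP; apply: contraLR max2 => /existsPn ni.
  by rewrite -ltnNge ltnS; apply/bigmax_leqP => i _; rewrite leqNgt ni.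
rewrite (bigD1 i)//= [ltRHS](bigD1 i)//= ltr_leD ?row_risk_O_lt_ML//.
by apply: ler_sum => l _; exact: row_risk_O_le_ML.
Qed.

End Risk.

(** * The three estimators as multiples of the entries *)

Section Multipliers.
Context {R : realType} {m : nat} {n : 'I_m -> nat}.
Hypothesis n_gt0 : forall i, (0 < n i)%N.
Variables (x : array n nat) (y : 'I_m -> nat).
Arguments x : clear implicits.

(** Reconciles the real subtractions in the estimators with the predecessors in the multipliers. *)
Let natrB1 k : (0 < k)%N -> k%:R - 1 = k.-1%:R :> R.
Proof. by move=> k0; rewrite -subn1 natrB. Qed.

Lemma lambda_MLE i j : lambda_ML R x y i j =
  mult_ML i (row_count x) y * (x i j)%:R.
Proof. by rewrite /lambda_ML /mult_ML; ring. Qed.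

Lemma lambda_OE i j : lambda_O R x y i j =
  mult_O (n := n) i (row_count x) y * (x i j)%:R.
Proof.
by rewrite /lambda_O /mult_O -!(addrA _ _ (-1)) natrB1// natrD; ring.
Qed.

Lemma lambda_hatE i j : (0 < m)%N -> lambda_hat R x y i j =
  mult_hat (n := n) i (row_count x) y * (x i j)%:R.
Proof.
move=> m0; rewrite /lambda_hat /mult_hat -!(addrA _ _ (-1)) !natrB1// -!natrD.
by rewrite -[(\sum_i _ + \sum_i _)%N]/(total _ _) !natrD; ring.
Qed.

End Multipliers.

(** * Dominance from the comparison of row risks *)

Theorem theorem3p1 (R : realType) (m : nat) (n : 'I_m -> nat)
  (m_gt0 : (0 < m)%N) (n_gt0 : forall i, (0 < n i)%N)
  (d : measure_display) (T : measurableType d)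
  (P : array n R -> probability T R)
  (X : array n {mfun T >-> nat}) (Y : 'I_m -> {mfun T >-> nat})
  (X_poisson : forall lam, param_space lam ->
    forall (i : 'I_m) (j : 'I_(n i)),
      poisson_distributed (P lam) (X i j) (lam i j))
  (Y_poisson : forall lam, param_space lam ->
    forall i : 'I_m, poisson_distributed (P lam) (Y i) (row_sum lam i))
  (XY_independent : forall lam, param_space lam ->
    mutually_independent (P lam) (observations X Y)) :
  ((2 <= \max_(i < m) n i)%N ->
     dominated_by P X Y (lambda_ML R) (lambda_O R)) /\
  ((2 <= m)%N ->
   (forall i, (4 <= n i)%N) ->
   (forall i,
      (m%:R - 1) ^+ 2 / (2 * m%:R) + (m%:R - 1) / m%:R ^+ 2
        + (2 * (n i)%:R - 3) / m%:R
      <= ((n i)%:R - 1) * ((n i)%:R - 3) / 2 :> R) ->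
     dominated_by P X Y (lambda_O R) (lambda_hat R)).
Proof.
pose rr lam := row_risk (P lam) X Y lam.
have riskML lam : param_space lam -> risk P X Y (lambda_ML R) lam =
    (\sum_i rr lam i (@mult_ML R m i))%:E.
  move=> lam0; apply: risk_multiplier; auto.
    by move=> i; exact: tame_mult_ML.
  by move=> x y i j; exact: lambda_MLE.
have riskO lam : param_space lam -> risk P X Y (lambda_O R) lam =
    (\sum_i rr lam i (@mult_O R m n i))%:E.
  move=> lam0; apply: risk_multiplier; auto.
    by move=> i; exact: tame_mult_O.
  by move=> x y i j; exact: lambda_OE.
have riskH lam : param_space lam -> risk P X Y (lambda_hat R) lam =
    (\sum_i rr lam i (@mult_hat R m n i))%:E.
  move=> lam0; apply: risk_multiplier; auto.
    by move=> i; exact: tame_mult_hat.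
  by move=> x y i j; exact: lambda_hatE.
(* Strict inequality holds at every parameter in both parts; the constant array 1 is a convenient
   witness. *)
have one0 : param_space ((fun _ _ => 1) : array n R) by move=> i j /=.
split=> [max2|m2 n4 _].
  split=> [lam lam0|]; last exists (fun _ _ => 1) => //.
    rewrite riskO// riskML// lee_fin; apply: sum_row_risk_O_le_ML; auto.
  rewrite riskO// riskML// lte_fin; apply: sum_row_risk_O_lt_ML; auto.
have lt lam : param_space lam ->
    (risk P X Y (lambda_hat R) lam < risk P X Y (lambda_O R) lam)%E.
  move=> lam0; rewrite riskO// riskH// lte_fin.
  apply: sum_row_risk_O_hat; auto.
split=> [lam lam0|]; last exists (fun _ _ => 1) => //; last exact: lt.
exact/ltW/lt.
Qed.
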